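(* Let $Q_\infty=(q_0,q_1,\dots,q_i,\dots)$ be any stochastic vector (all $q_i>0$, $\sum_{i=0}^\infty q_i=1$). Then the set $L(Q_\infty)$ of $Q_\infty$-essentially non-normal numbers is of full Hausdorff dimension, i.e. $\dim_H(L(Q_\infty))=1$.
   Context: $\mathbb{N}_0=\{0,1,2,\dots\}$, $\mathbb{N}=\{1,2,\dots\}$. Let $Q_\infty=(q_0,q_1,\dots)$ be a stochastic vector with all $q_i>0$ and $\sum_{i=0}^\infty q_i=1$. Decompose $[0,1)$ from left to right into consecutive disjoint half-open intervals $\Delta_{\alpha_1}$, $\alpha_1\in\mathbb{N}_0$, of length $q_{\alpha_1}$; that is, $\Delta_i=[\sum_{j<i}q_j,\ \sum_{j\le i}q_j)$. Inductively, for $n\ge 2$, decompose each $\Delta_{\alpha_1\dots\alpha_{n-1}}$ from left to right into consecutive disjoint half-open intervals $\Delta_{\alpha_1\dots\alpha_n}$, $\alpha_n\in\mathbb{N}_0$, (closed on the left, open on the right) of length $q_{\alpha_1}q_{\alpha_2}\cdots q_{\alpha_n}$. For every $x\in[0,1)$ there is a unique sequence $(\alpha_n(x))_{n\ge1}$ in $\mathbb{N}_0$ with $x\in\Delta_{\alpha_1(x)\dots\alpha_n(x)}$ for all $n$; the $\alpha_n(x)$ are the digits of the $Q_\infty$-expansion of $x$. For $i\in\mathbb{N}_0$ let $N_i(x,n)$ be the number of digits equal to $i$ among the first $n$ digits $\alpha_1(x),\dots,\alpha_n(x)$. The set of $Q_\infty$-essentially non-normal numbers is $$L(Q_\infty)=\Big\{x\in[0,1):\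 \forall i\in\mathbb{N}_0,\ \liminf_{n\to\infty}\frac{N_i(x,n)}{n}<\limsup_{n\to\infty}\frac{N_i(x,n)}{n}\Big\}.$$ $\dim_H$ denotes the classical Hausdorff dimension. *)

(* Defs.v *)
From HB Require Import structures.
From mathcomp Require Import all_boot all_order all_algebra.
From mathcomp Require Import all_classical all_reals all_analysis.
From mathcomp Require Import lra.

Set Implicit Arguments.
Unset Strict Implicit.
Unset Printing Implicit Defensive.

Import Order.TTheory GRing.Theory Num.Theory.
Import numFieldNormedType.Exports.

Local Open Scope classical_set_scope.
Local Open Scope ring_scope.

Section HausdorffDimension.
Context {R : realType}.
Implicit Types (A E : set R) (s delta : R).

(* The empty set is singled out because ereal_sup set0 = -oo. *)
Definition diam A : \bar R :=
  if A == set0 then 0%E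
  else ereal_sup [set (`|z.1 - z.2|)%:E | z in A `*` A].

(* With s = 0 every nonempty set weighs 1 (0 `^ 0 = 1) and the empty set 0,
   so that padding a finite cover with empty sets is free. *)
Definition diam_pow s A : \bar R :=
  if A == set0 then 0%E else (diam A `^ s)%E.

Definition delta_cover delta E : set ((set R)^nat) :=
  [set U : (set R)^nat |
    (forall k, (diam (U k) <= delta%:E)%E) /\ E `<=` \bigcup_k U k].

Definition hausdorff_content delta s E : \bar R :=
  ereal_inf [set (\sum_(k <oo) diam_pow s (U k))%E | U in delta_cover delta E].

(* The supremum over delta > 0 is the limit as delta tends to 0+, the content
   being nonincreasing in delta. *)
Definition hausdorff_measure s E : \bar R :=
  ereal_sup [set hausdorff_content delta s E | delta in [set d : R | 0 < d]].

Definition hausdorff_dim E : \bar R :=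
  ereal_inf [set s%:E | s in [set s : R | 0 <= s /\ hausdorff_measure s E = 0%E]].

End HausdorffDimension.

Section QExpansion.
Context {R : realType}.
Variable q : R^nat.
Implicit Types (x : R) (a : nat -> nat) (n i : nat).

(* Digits are indexed from 0: a k is the (k+1)-st digit, so that a word of
   rank n consists of a 0, ..., a n.-1. *)
Definition cyl_length a n : R := \prod_(k < n) q (a k).

(* The children of a cylinder fill it from left to right, the j-th one having
   q j times its length. *)
Fixpoint cyl_left a n : R :=
  if n is m.+1 then cyl_left a m + cyl_length a m * \sum_(j < a m) q j else 0.

Definition cylinder a n : set R :=
  `[cyl_left a n, cyl_left a n + cyl_length a n[%classic.

Definition is_expansion x a := forall n, cylinder a n x.

(* Well defined on [0, 1[ by digitsP below; the default value is only used
   outside of it. *)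
Definition digits x : nat -> nat := xget (fun=> 0%N) [set a | is_expansion x a].

Definition digit_count i x n : nat := count_mem i (mkseq (digits x) n).

Definition digit_freq i x : R^nat := fun n => (digit_count i x n)%:R / n%:R.

Definition essentially_nonnormal : set R :=
  [set x | 0 <= x < 1 /\
    forall i, limn_inf (digit_freq i x) < limn_sup (digit_freq i x)].

Hypothesis q_gt0 : forall i, 0 < q i.
Hypothesis q_sum1 : series q @ \oo --> (1 : R).

Let psum n : R := \sum_(j < n) q j.

Let psum_le m n : (m <= n)%N -> psum m <= psum n.
Proof.
move=> /subnK <-; elim: (n - m)%N => [|k IH]; first by rewrite add0n.
by rewrite addSn /psum big_ord_recr/= (le_trans IH)// lerDl ltW.
Qed.

Let psumS n : psum n.+1 = psum n + q n.
Proof. by rewrite /psum big_ord_recr. Qed.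

Let digit_ex (y : R) : 0 <= y < 1 -> exists i, psum i <= y < psum i.+1.
Proof.
move=> /andP[y0 y1].
have ex : exists n, y < psum n.
  have : \forall n \near \oo, y < series q n.
    by apply: (cvgr_gt (1 : R) q_sum1).
  case=> N _ /(_ N (leqnn N)) /= h; exists N.
  by move: h; rewrite /series/= big_mkord.
case: (ex_minnP ex) => -[|i] yi mi.
  by move: yi; rewrite /psum big_ord0 ltNge y0.
exists i; rewrite yi andbT leNgt; apply/negP => /mi; by rewrite ltnn.
Qed.

Let digit_uniq y i j :
  psum i <= y < psum i.+1 -> psum j <= y < psum j.+1 -> i = j.
Proof.
have le k l : psum k <= y < psum k.+1 -> psum l <= y < psum l.+1 -> (k <= l)%N.
  move=> /andP[ky _] /andP[_ yl]; rewrite leqNgt; apply/negP => /psum_le lk.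
  by have := lt_le_trans yl (le_trans lk ky); rewrite ltxx.
by move=> hi hj; apply/eqP; rewrite eqn_leq !le.
Qed.

Let cyl_length_gt0 a n : 0 < cyl_length a n.
Proof. exact: prodr_gt0. Qed.

Let cylinderS a n x : cylinder a n.+1 x <->
  psum (a n) <= (x - cyl_left a n) / cyl_length a n < psum (a n).+1.
Proof.
rewrite /cylinder/= in_itv/= psumS -/(psum _).
have := cyl_length_gt0 a n => L0.
have -> : cyl_length a n.+1 = cyl_length a n * q (a n).
  by rewrite /cyl_length big_ord_recr.
rewrite ler_pdivlMr// ltr_pdivrMr//.
by split=> /andP[h1 h2]; apply/andP; split; lra.
Qed.

Let cylinder_unit a n x : cylinder a n x ->
  0 <= (x - cyl_left a n) / cyl_length a n < 1.
Proof.
rewrite /cylinder/= in_itv/= => /andP[h1 h2].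
rewrite divr_ge0 ?subr_ge0 ?(ltW (cyl_length_gt0 a n))//=.
by rewrite ltr_pdivrMr// mul1r ltrBlDl.
Qed.

Let cyl_ext a b n : (forall k, (k < n)%N -> a k = b k) ->
  cyl_length a n = cyl_length b n /\ cyl_left a n = cyl_left b n.
Proof.
elim: n => [|n IH] ab; first by rewrite /cyl_length !big_ord0.
have [|e1 e2] := IH; first by move=> k kn; apply: ab; rewrite ltnW.
have -> /= : cyl_length a n.+1 = cyl_length b n.+1.
  by apply: eq_bigr => k _; rewrite ab.
by rewrite e1 e2 ab.
Qed.

Lemma expansion_exists x : 0 <= x < 1 -> exists a, is_expansion x a.
Proof.
move=> x01.
pose d y := xget 0%N [set i | psum i <= y < psum i.+1].
(* state: left endpoint and length of the current cylinder *)
pose dg (s : R * R) := d ((x - s.1) / s.2).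
pose step (s : R * R) := (s.1 + s.2 * psum (dg s), s.2 * q (dg s)).
pose st n := iter n step (0, 1).
pose a n := dg (st n).
have stE n : st n = (cyl_left a n, cyl_length a n).
  elim: n => [|n IH]; first by rewrite /cyl_length big_ord0.
  rewrite /st iterS -/(st n) /step -/(a n) IH/=.
  by rewrite /cyl_length big_ord_recr.
exists a; elim => [|n IH].
  by rewrite /cylinder/= in_itv/= /cyl_length big_ord0 add0r.
apply/cylinderS.
have := xgetPex 0%N (digit_ex (cylinder_unit IH)).
by rewrite -[xget _ _]/(d _) -[d _]/(dg (cyl_left a n, cyl_length a n)) -stE.
Qed.

Lemma expansion_unique x a b : is_expansion x a -> is_expansion x b -> a = b.
Proof.
move=> ha hb; apply/funext => n; elim/ltn_ind: n => n IH.
have [e1 e2] := cyl_ext IH.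
have /cylinderS h1 := ha n.+1; have /cylinderS h2 := hb n.+1.
by move: h1; rewrite e1 e2 => h1; exact: digit_uniq h1 h2.
Qed.

Lemma digitsP x a : 0 <= x < 1 -> is_expansion x a <-> digits x = a.
Proof.
move=> /expansion_exists [b hb].
have hd : is_expansion x (digits x).
  by apply: (@xgetPex _ _ [set a | is_expansion x a]); exists b.
by split=> [ha|<-//]; exact: expansion_unique ha.
Qed.

End QExpansion.

(* Main.v *)
Require Import Defs.
From mathcomp Require Import all_boot all_order all_algebra.
From mathcomp Require Import all_classical all_reals all_analysis.
From mathcomp Require Import zify ring lra.

Import Order.TTheory GRing.Theory Num.Theory.
Import numFieldNormedType.Exports.

Local Open Scope classical_set_scope.
Local Open Scope ring_scope.

(** For [s < 1], insert digits into the expansion of an arbitrary [x] in [0, 1),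
    at a fixed periodic set of positions of so small a density that the inserted
    digits shrink a cylinder of rank [n] at most by a factor [rho ^ n], for a
    prescribed [rho < 1]. The inserted digits are chosen along rapidly growing phases,
    depending on [x], in such a way that every frequency oscillates: the phase of
    digit [i] inserts a few more [i]'s and ends where the resulting frequency of
    [i] is near its limsup. So every [x] yields a point of the set, whether or not
    the frequencies of [x] converge, and no law of large numbers is needed.
    Deleting the inserted digits then maps a subset of the set onto [0, 1); the
    part of it lying in a set of diameter [d] is covered by pairwise disjoint
    cylinders that are maximal among those of length at most [d], and comparing
    lengths before and after the deletion bounds the outer measure of its image by
    [C * d ^ s]. A cover with small [s]-sum would hence make [0, 1) too small. *)

(** * Oscillating frequencies *)

Section LimitsOfBoundedSequences.
Context {R : realType}.
Variable u : R^nat.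
Hypothesis u_bnd : bounded_fun u.

Let ub_u : has_ubound (range u). Proof. exact: bounded_fun_has_ubound. Qed.
Let lb_u : has_lbound (range u). Proof. exact: bounded_fun_has_lbound. Qed.

Lemma limn_sup_ge (A : R) :
  (forall N, exists2 n, (N <= n)%N & A <= u n) -> A <= limn_sup u.
Proof.
move=> h; rewrite limn_supE//; apply: lb_le_inf; first by exists (sups u 0%N), 0%N.
move=> _ [N _ <-]; have [n Nn An] := h N; apply: (le_trans An).
by apply: ub_le_sup; [exact: has_ubound_sdrop|exists n].
Qed.

Lemma limn_sup_le (A : R) N :
  (forall n, (N <= n)%N -> u n <= A) -> limn_sup u <= A.
Proof.
move=> h; rewrite limn_supE//.
apply: (@le_trans _ _ (sups u N)).
  by apply: ge_inf; [exact: bounded_fun_has_lbound_sups|exists N].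
apply: ge_sup; first by exists (u N), N => /=.
by move=> _ [n /= Nn <-]; exact: h.
Qed.

Lemma limn_inf_le (A : R) :
  (forall N, exists2 n, (N <= n)%N & u n <= A) -> limn_inf u <= A.
Proof.
move=> h; rewrite limn_infE//; apply: ge_sup; first by exists (infs u 0%N), 0%N.
move=> _ [N _ <-]; have [n Nn An] := h N; apply: le_trans An.
by apply: ge_inf; [exact: has_lbound_sdrop|exists n].
Qed.

Lemma frequently_lt_limn_sup (A : R) N : A < limn_sup u ->
  exists2 n, (N <= n)%N & A < u n.
Proof.
move=> Au; apply: contrapT => /forall2NP h.
move: Au; rewrite ltNge => /negP; apply; apply: (@limn_sup_le _ N) => n Nn.
by rewrite leNgt; apply/negP; have [|] := h n.
Qed.

Lemma eventually_lt_limn_sup (A : R) : limn_sup u < A ->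
  exists N, forall n, (N <= n)%N -> u n < A.
Proof.
move=> uA; apply: contrapT => /forallNP h.
move: uA; rewrite ltNge => /negP; apply; apply: limn_sup_ge => N.
by have /existsNP[n /not_implyP[Nn /negP]] := h N; rewrite -leNgt; exists n.
Qed.

End LimitsOfBoundedSequences.

Definition occ (i : nat) (a : nat -> nat) (n : nat) : nat := count_mem i (mkseq a n).

Definition occ_freq {R : realType} (i : nat) (a : nat -> nat) : R^nat :=
  fun n => (occ i a n)%:R / n%:R.

Lemma occS i a n : occ i a n.+1 = (occ i a n + (a n == i))%N.
Proof. by rewrite /occ mkseqS -cats1 count_cat /= addn0. Qed.

Lemma occ_le i a n : (occ i a n <= n)%N.
Proof. by rewrite (leq_trans (count_size _ _))// size_mkseq. Qed.

Lemma occ_agree i a b T n : (forall p, (T <= p < n)%N -> a p = b p) ->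
  (occ i a n <= occ i b n + T)%N.
Proof.
elim: n => [//|n IH] ab; have [nT|Tn] := ltnP n T.
  by rewrite (leq_trans (occ_le i a n.+1))// (leq_trans nT)// leq_addl.
have := IH _; rewrite !occS ab ?Tn ?ltnSn// => h.
suff : (occ i a n <= occ i b n + T)%N by lia.
by apply: h => p /andP[Tp pn]; apply: ab; rewrite Tp ltnW.
Qed.

Lemma occ_freq_bounded (R : realType) i a : bounded_fun (@occ_freq R i a).
Proof.
exists 1; split=> // M M1 n _ /=; apply: le_trans (ltW M1).
rewrite ger0_norm ?divr_ge0// /occ_freq.
have [->|n0] := posnP n; first by rewrite invr0 mulr0.
by rewrite ler_pdivrMr ?ltr0n// mul1r ler_nat occ_le.
Qed.

(** Makes [k |-> (logn 2 k.+1, logn 3 k.+1)] a schedule that returns to every pair infinitely often;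
    the free factor [5 ^ N] pushes [k] past [N]. *)
Lemma frequently_logn i v N :
  exists2 k, (N <= k)%N & (logn 2 k.+1, logn 3 k.+1) = (i, v).
Proof.
have e : ((2 ^ i * 3 ^ v * 5 ^ N).-1.+1 = 2 ^ i * 3 ^ v * 5 ^ N)%N.
  by rewrite prednK// !muln_gt0 !expn_gt0.
exists (2 ^ i * 3 ^ v * 5 ^ N).-1; last first.
  rewrite e !lognM ?muln_gt0 ?expn_gt0// !lognX !logn_prime//=.
  by congr (_, _); lia.
rewrite -ltnS e (@leq_trans (5 ^ N)%N)//; first exact: ltn_expl.
by rewrite leq_pmull// muln_gt0 !expn_gt0.
Qed.

(** Phase [k] of [c] copies [s (ev k)] and lasts so long that at its end the frequencies are nearly
    those of the copied sequence. Phases scheduled for [(i, v)] end near the limsup of [i] in [s v],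
    those for [(i, w)] not much above its limsup in [s w]. *)
Lemma oscillating_mixture (R : realType) (s : nat -> nat -> nat) :
  exists c : nat -> nat, (forall p, exists v, c p = s v p) /\
  forall i v w,
    limn_sup (@occ_freq R i (s w)) < limn_sup (@occ_freq R i (s v)) ->
    limn_inf (@occ_freq R i c) < limn_sup (@occ_freq R i c).
Proof.
pose fr i v := @occ_freq R i (s v).
have bfr i a := @occ_freq_bounded R i a.
pose ei k := logn 2 k.+1; pose ev k := logn 3 k.+1.
(* Phase number [z.2], started at [z.1], gets an end that is far away and at which the scheduled
   digit is almost as frequent as its limsup. *)
have nextP (z : nat * nat) : exists T', (z.2.+1 * z.1.+1 <= T')%N /\
    limn_sup (fr (ei z.2) (ev z.2)) - harmonic z.2 < fr (ei z.2) (ev z.2) T'.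
  have [|T' h1 h2] := @frequently_lt_limn_sup R _ (bfr (ei z.2) (s (ev z.2)))
    (limn_sup (fr (ei z.2) (ev z.2)) - harmonic z.2) (z.2.+1 * z.1.+1).
    by rewrite ltrBlDr ltrDl harmonic_gt0.
  by exists T'.
have [nx nxP] := choice nextP.
(* [t k] is the start of the phase number [k]; as [(k + 1) * t k <= t k.+1], what happened
   before a phase does not matter at its end. *)
pose t := fix t k := if k is k'.+1 then nx (t k', k') else 0%N.
have tS k : (k.+1 * (t k).+1 <= t k.+1)%N by have [] := nxP (t k, k).
have tlt k : (t k < t k.+1)%N by have := tS k; nia.
have tge k : (k <= t k)%N by elim: k => // k IH; exact: leq_ltn_trans (tlt k).
have tmono k l : (k <= l)%N -> (t k <= t l)%N.
  move=> /subnK <-; elim: (l - k)%N => // m IH.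
  by rewrite addSn (leq_trans IH)// ltnW.
have ex p : exists k, (p < t k.+1)%N by exists p; exact: tge.
pose kk p := ex_minn (ex p).
have kkE k p : (t k <= p < t k.+1)%N -> kk p = k.
  move=> /andP[kp pk]; rewrite /kk; case: ex_minnP => m pm mm.
  apply/eqP; rewrite eqn_leq mm//= leqNgt; apply/negP => mk.
  by have := tmono _ _ mk; lia.
pose c p := s (ev (kk p)) p.
exists c; split; first by move=> p; exists (ev (kk p)).
(* The counts differ by at most [t k], the length of what precedes the phase, and
   [t k / t k.+1 <= 1 / (k + 1)]. *)
have near_phase i k : `|occ_freq i c (t k.+1) - fr i (ev k) (t k.+1)| <= (harmonic k : R).
  have t0 : (0 < t k.+1)%N by apply: leq_ltn_trans (tlt k).
  rewrite /fr /occ_freq -mulrBl normrM (ger0_norm (_ : 0 <= (t k.+1)%:R^-1))//.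
  rewrite /harmonic ler_pdivrMr ?ltr0n// mulrC ler_pdivlMr ?ltr0n//.
  have agree p : (t k <= p < t k.+1)%N -> c p = s (ev k) p.
    by move=> /kkE; rewrite /c => ->.
  have := occ_agree i _ _ _ _ agree.
  have := occ_agree i _ _ _ _ (fun p h => esym (agree p h)).
  rewrite -!(ler_nat R) !natrD => h1 h2.
  apply: (@le_trans _ _ ((t k)%:R * k.+1%:R)).
    by rewrite ler_wpM2r// ler_norml; apply/andP; split; lra.
  by rewrite -natrM ler_nat mulnC (leq_trans _ (tS k))// leq_mul2l leqnSn orbT.
move: (@harmonic R) (@cvg_harmonic R) nextP nxP near_phase => r r0 _ nxP near_phase.
move=> i v w; rewrite -/(fr i v) -/(fr i w).
pose Sv : R := limn_sup (fr i v); pose Sw : R := limn_sup (fr i w) => Svw.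
have {}Svw : Sw < Sv by [].
(* Two errors of size [e] occur on either side, and [4 * e] stays below the gap [5 * e]. *)
pose e : R := (Sv - Sw) / 5.
have e0 : 0 < e by rewrite divr_gt0 ?subr_gt0.
have [N0 N0P] : exists N0, forall k, (N0 <= k)%N -> r k <= e.
  have [N0 _ hN] := cvgr_lt 0 r0 _ e0.
  by exists N0 => k /hN /ltW.
have [N1 N1P] : exists N, forall n, (N <= n)%N -> fr i w n < (Sw + e : R).
  by apply: eventually_lt_limn_sup; rewrite ?ltrDl//; exact: bfr.
have lo : limn_inf (@occ_freq R i c) <= (Sw + e + e : R).
  apply: limn_inf_le; first exact: bfr.
  move=> N; have [k] := frequently_logn i w (maxn N (maxn N0 N1)).
  rewrite !geq_max => /andP[Nk /andP[N0k N1k]] [ik vk].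
  have kt : (k <= t k.+1)%N by exact: leq_trans (tge k.+1).
  exists (t k.+1); first exact: leq_trans kt.
  have := N1P _ (leq_trans N1k kt); have := N0P _ N0k.
  have := near_phase i k; rewrite /ev vk ler_norml => /andP[_] h1 h2 h3.
  lra.
apply: (le_lt_trans lo); apply: (@lt_le_trans _ R (Sv - e - e)); first by rewrite /e; lra.
apply: limn_sup_ge; first exact: bfr.
move=> N; have [k] := frequently_logn i v (maxn N N0).
rewrite !geq_max => /andP[Nk N0k] [ik vk].
have kt : (k <= t k.+1)%N by exact: leq_trans (tge k.+1).
exists (t k.+1); first exact: leq_trans kt.
have [_] := nxP (t k, k); rewrite /= -/(t k.+1) /ei /ev ik vk -/Sv.
have := N0P _ N0k.
have := near_phase i k; rewrite /ev vk ler_norml => /andP[+ _].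
move=> h1 h2 h3.
lra.
Qed.

(** * Cylinders *)

Section Cylinders.
Context {R : realType}.
Variable q : R^nat.
Hypothesis q_gt0 : forall i, 0 < q i.
Hypothesis q_sum1 : series q @ \oo --> (1 : R).
Implicit Types (a b : nat -> nat) (n : nat) (w : seq nat) (x : R).

Lemma psum_lt1 n : \sum_(j < n) q j < 1.
Proof.
have nd : nondecreasing_seq (series q).
  apply/nondecreasing_seqP => n'; rewrite /series/= big_nat_recr//= lerDl.
  exact: ltW.
have := nondecreasing_cvgn_le nd (cvgP _ q_sum1) n.+1.
rewrite (cvg_lim _ q_sum1)// /series/= big_mkord big_ord_recr/=.
by apply: lt_le_trans; rewrite ltrDl.
Qed.

Lemma psum_le m n : (m <= n)%N -> \sum_(j < m) q j <= \sum_(j < n) q j.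
Proof.
move=> /subnK <-; elim: (n - m)%N => [|k IH]; first by rewrite add0n.
by rewrite addSn big_ord_recr/= (le_trans IH)// lerDl ltW.
Qed.

(** Two positive weights keep any single one from exhausting the mass: [1 - q 0] bounds every [q i]
    with [i > 0], and [1 - q 1] bounds [q 0]. *)
Lemma weights_bounded_away : exists2 t : R, 0 < t < 1 & forall i, q i <= t.
Proof.
have q01 := psum_lt1 2; rewrite big_ord_recr big_ord1/= in q01.
have q0 := q_gt0 0; have q1 := q_gt0 1.
exists (Num.max (1 - q 0%N) (1 - q 1%N)).
  by rewrite lt_max gt_max; apply/andP; split; [apply/orP; left|apply/andP; split]; lra.
move=> [|i]; rewrite le_max; apply/orP; first by right; lra.
left; have := psum_lt1 i.+2; rewrite big_ord_recl big_ord_recr/=.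
have : 0 <= \sum_(j < i) q (bump 0 j) by apply: sumr_ge0 => j _; exact: ltW.
rewrite /bump/= => ? ?; lra.
Qed.

Lemma cyl_length_gt0 a n : 0 < cyl_length q a n.
Proof. exact: prodr_gt0. Qed.

Lemma cyl_lengthS a n : cyl_length q a n.+1 = cyl_length q a n * q (a n).
Proof. by rewrite /cyl_length big_ord_recr. Qed.

Lemma cyl_length_le a t n : (forall i, q i <= t) -> cyl_length q a n <= t ^+ n.
Proof.
move=> qt; elim: n => [|n IH]; first by rewrite /cyl_length big_ord0 expr0.
by rewrite cyl_lengthS exprSr ler_pM// ltW// cyl_length_gt0.
Qed.

Lemma eq_cylinder {a b n} : (forall k, (k < n)%N -> a k = b k) ->
  cyl_length q a n = cyl_length q b n /\ cyl_left q a n = cyl_left q b n.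
Proof.
elim: n => [|n IH] ab; first by rewrite /cyl_length !big_ord0.
have [|e1 e2] := IH; first by move=> k kn; apply: ab; rewrite ltnW.
by rewrite !cyl_lengthS /= e1 e2 ab.
Qed.

Lemma cyl_left_le a n : cyl_left q a n <= cyl_left q a n.+1.
Proof.
rewrite /= lerDl mulr_ge0// ?(ltW (cyl_length_gt0 _ _))//.
by apply: sumr_ge0 => j _; exact: ltW.
Qed.

Lemma cyl_right_lt a n :
  cyl_left q a n.+1 + cyl_length q a n.+1 < cyl_left q a n + cyl_length q a n.
Proof.
rewrite cyl_lengthS/= -addrA -mulrDr ltrD2l gtr_pMr ?cyl_length_gt0//.
by have := psum_lt1 (a n).+1; rewrite big_ord_recr.
Qed.

Lemma cylinder_subset a m n : (m <= n)%N -> cylinder q a n `<=` cylinder q a m.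
Proof.
move=> /subnK <-; elim: (n - m)%N => // k IH x.
rewrite addSn => xk; apply: IH; move: xk; rewrite /cylinder/= !in_itv/=.
have := cyl_left_le a (k + m); have := cyl_right_lt a (k + m) => /=.
by move=> ? ? /andP[? ?]; apply/andP; split; lra.
Qed.

Lemma cylinder01 a n x : cylinder q a n x -> 0 <= x < 1.
Proof.
move=> /(cylinder_subset a 0 n (leq0n n)).
by rewrite /cylinder/= in_itv/= /cyl_length big_ord0 add0r.
Qed.

(* Since the alphabet is infinite, a child never touches the right endpoint of
   its parent, so nested cylinders always meet. *)
Lemma expansion_realized a : exists x, is_expansion q x a.
Proof.
have nd : nondecreasing_seq (cyl_left q a).
  by apply/nondecreasing_seqP => n; exact: cyl_left_le.
have ni : nonincreasing_seq (fun n => cyl_left q a n + cyl_length q a n).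
  by apply/nonincreasing_seqP => n; exact: ltW (cyl_right_lt a n).
have ub n m : cyl_left q a m <= cyl_left q a n + cyl_length q a n.
  apply: (@le_trans _ _ (cyl_left q a (maxn m n) + cyl_length q a (maxn m n))).
    apply: (@le_trans _ _ (cyl_left q a (maxn m n))).
      by apply: nd; rewrite leq_maxl.
    by rewrite lerDl ltW// cyl_length_gt0.
  by apply: ni; rewrite leq_maxr.
have hub : has_ubound (range (cyl_left q a)).
  by exists (cyl_left q a 0 + cyl_length q a 0) => _ [m _ <-].
exists (sup (range (cyl_left q a))) => n; rewrite /cylinder/= in_itv/=.
apply/andP; split; first by apply: ub_le_sup => //; exists n.
apply: le_lt_trans (cyl_right_lt a n); apply: ge_sup.
  by exists (cyl_left q a 0), 0%N.
by move=> _ [m _ <-]; exact: ub.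
Qed.

Lemma cylinder_inj a b n x : cylinder q a n x -> cylinder q b n x ->
  forall k, (k < n)%N -> a k = b k.
Proof.
elim: n => // n IH xa xb.
have ab : forall k, (k < n)%N -> a k = b k.
  by apply: IH; [apply: cylinder_subset xa|apply: cylinder_subset xb].
have [e1 e2] := eq_cylinder ab.
have order c d : cyl_length q c n = cyl_length q d n ->
    cyl_left q c n = cyl_left q d n -> cylinder q c n.+1 x -> cylinder q d n.+1 x ->
    (c n <= d n)%N.
  move=> f1 f2; rewrite /cylinder/= !in_itv/= !cyl_lengthS f1 f2.
  move=> /andP[xc _] /andP[_ xd]; rewrite leqNgt; apply/negP => /psum_le.
  rewrite big_ord_recr/= -(ler_pM2l (cyl_length_gt0 d n)) mulrDr => h.
  by have := le_lt_trans xc xd; rewrite -addrA ltrD2l ltNge h.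
move=> k; rewrite ltnS leq_eqVlt => /orP[/eqP ->|]; last exact: ab.
by apply/eqP; rewrite eqn_leq !order.
Qed.

(** Words as finite sequences form a countable type, so that families of cylinders can be enumerated
    by [nat] below; the default [0] of [nth] is never read. *)
Definition wcyl w : set R := cylinder q (nth 0%N w) (size w).

Definition wlen w : R := \prod_(i <- w) q i.

Lemma wlen_gt0 w : 0 < wlen w.
Proof. exact: prodr_gt0. Qed.

Lemma wlenE w : wlen w = cyl_length q (nth 0%N w) (size w).
Proof. by rewrite /wlen /cyl_length (big_nth 0%N) big_mkord. Qed.

Lemma wlen_mkseq a n : wlen (mkseq a n) = cyl_length q a n.
Proof.
by rewrite wlenE size_mkseq; apply: eq_bigr => k _; rewrite nth_mkseq.
Qed.

Lemma digits_expansion x : 0 <= x < 1 -> is_expansion q x (digits q x).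
Proof. by move=> x01; apply/(digitsP q_gt0 q_sum1). Qed.

Lemma wcylP w x : wcyl w x <-> 0 <= x < 1 /\ w = mkseq (digits q x) (size w).
Proof.
split=> [wx|[x01 ->]]; last first.
  rewrite /wcyl size_mkseq /cylinder.
  have [|-> ->] :=
    @eq_cylinder (nth 0%N (mkseq (digits q x) (size w))) (digits q x) (size w).
    by move=> k kn; rewrite nth_mkseq.
  exact: digits_expansion.
have x01 := cylinder01 _ _ _ wx; split=> //.
apply: (@eq_from_nth _ 0%N); rewrite ?size_mkseq// => k kn.
by rewrite nth_mkseq// (cylinder_inj _ _ _ _ wx (digits_expansion _ x01 _)).
Qed.

Lemma measurable_wcyl w : measurable (wcyl w).
Proof. exact: measurable_itv. Qed.

Lemma lebesgue_wcyl w : lebesgue_measure (wcyl w) = (wlen w)%:E.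
Proof.
rewrite /wcyl /cylinder lebesgue_measure_itv/= wlenE lte_fin ltrDl cyl_length_gt0.
by rewrite -EFinB addrAC subrr add0r.
Qed.

Lemma wcyl_diam w x y : wcyl w x -> wcyl w y -> `|x - y| <= wlen w.
Proof.
rewrite /wcyl /cylinder/= !in_itv/= wlenE => /andP[? ?] /andP[? ?].
by rewrite ler_norml; apply/andP; split; lra.
Qed.

End Cylinders.

(** * Deleting inserted digits *)

Section Deletion.
Context {R : realType}.
Variable q : R^nat.
Variable ins : pred nat.
Implicit Types (a b : nat -> nat) (n : nat) (w : seq nat).

Definition free_digits a n : seq nat := [seq a p | p <- iota 0 n & ~~ ins p].

Definition free_count n : nat := count (predC ins) (iota 0 n).

Definition ins_prod a n : R := \prod_(p < n | ins p) q (a p).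

Lemma free_digitsS a n :
  free_digits a n.+1 = free_digits a n ++ (if ins n then [::] else [:: a n]).
Proof.
by rewrite /free_digits -addn1 iotaD filter_cat map_cat /= add0n; case: (ins n).
Qed.

Lemma eq_free_digits a b n : (forall p, (p < n)%N -> a p = b p) ->
  free_digits a n = free_digits b n.
Proof.
elim: n => // n IH ab; rewrite !free_digitsS IH ?ab// => p pn.
by apply: ab; rewrite ltnW.
Qed.

Lemma eq_ins_prod a b n : (forall p, (p < n)%N -> a p = b p) ->
  ins_prod a n = ins_prod b n.
Proof. by move=> ab; apply: eq_bigr => p _; rewrite ab. Qed.

Lemma free_digits_mkseq a b n : (forall p, ~~ ins p -> b p = a (free_count p)) ->
  free_digits b n = mkseq a (free_count n).
Proof.
move=> ba; elim: n => // n IH; rewrite free_digitsS IH.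
have -> : free_count n.+1 = (free_count n + ~~ ins n)%N.
  by rewrite /free_count -addn1 iotaD count_cat /= add0n addn0.
case: ifPn => insn; first by rewrite addn0 cats0.
by rewrite addn1 mkseqS cats1 ba.
Qed.

Lemma wlen_free_digits a n : wlen q (free_digits a n) * ins_prod a n = cyl_length q a n.
Proof.
rewrite /wlen /free_digits big_map big_filter /cyl_length.
rewrite (bigID (fun p : 'I_n => ins p))/=.
rewrite mulrC; congr (_ * _).
by rewrite -[in LHS](subn0 n) -/(index_iota 0 n) big_mkord.
Qed.

End Deletion.

(** * Covering by stopped cylinders *)

Section CylinderCover.
Context {R : realType}.
Variable q : R^nat.
Hypothesis q_gt0 : forall i, 0 < q i.
Hypothesis q_sum1 : series q @ \oo --> (1 : R).
Variables (ins : pred nat) (t s : R).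
Hypothesis t01 : 0 < t < 1.
Hypothesis q_le : forall i, q i <= t.
Hypothesis s01 : 0 <= s < 1.

(* [z] is obtained from [x] by inserting digits at the positions in [ins]; the
   inserted digits among the first [n] have total weight at least
   [(t ^ (1 - s)) ^ n]. *)
Definition redigit (x z : R) : Prop :=
  (forall n, free_digits ins (digits q z) n = mkseq (digits q x) (free_count ins n)) /\
  (forall n, (t `^ (1 - s)) ^+ n <= ins_prod q ins (digits q z) n).

(** A stopping rule: a digit sequence is cut at the first rank where its cylinder has length at most
    [d]. The condition on the parent bounds the rank in terms of [d]. *)
Definition stopped (d : R) (w : seq nat) : bool :=
  [&& (0 < size w)%N, wlen q w <= d & d < wlen q (take (size w).-1 w)].

Lemma take_mkseq (a : nat -> nat) m n : (m <= n)%N -> take m (mkseq a n) = mkseq a m.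
Proof.
move=> mn; apply: (@eq_from_nth _ 0%N); first by rewrite size_takel size_mkseq.
move=> i; rewrite size_takel ?size_mkseq// => im.
by rewrite nth_take// !nth_mkseq// (leq_trans im).
Qed.

(** Lengths are at most [t ^ n] and so fall below [d]; the least rank where this happens is positive
    because the empty word has length [1 > d]. *)
Lemma stopped_exists (d : R) (a : nat -> nat) : 0 < d < 1 ->
  exists n, stopped d (mkseq a n).
Proof.
move=> /andP[d0 d1].
have ex : exists n, cyl_length q a n <= d.
  have /andP[t0 t1] := t01.
  have : t ^+ n @[n --> \oo] --> 0.
    by apply: cvg_expr; rewrite ger0_norm// ltW.
  move=> /cvgr_lt -/(_ d d0)[N _ /(_ N (leqnn N))/= h].
  by exists N; apply: le_trans (ltW h); exact: cyl_length_le.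
case: (ex_minnP ex) => -[|n] nd mn.
  by move: nd; rewrite /cyl_length big_ord0 leNgt d1.
exists n.+1; rewrite /stopped size_mkseq/= take_mkseq// !wlen_mkseq nd/=.
by rewrite ltNge; apply/negP => /mn; rewrite ltnn.
Qed.

(** Both words are prefixes of the digits of [x]. If one were longer, its parent would still have
    the other as a prefix, hence have length at most [d]. *)
Lemma stopped_uniq (d : R) (w w' : seq nat) x : stopped d w -> stopped d w' ->
  wcyl q w x -> wcyl q w' x -> w = w'.
Proof.
suff H v v' : stopped d v -> stopped d v' -> wcyl q v x -> wcyl q v' x ->
    (size v <= size v')%N.
  move=> sw sw' wx wx'; have e : size w = size w'.
    by apply/eqP; rewrite eqn_leq !H.
  move: wx wx' => /(wcylP _ q_gt0 q_sum1)[_ ->] /(wcylP _ q_gt0 q_sum1)[_ ->].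
  by rewrite e.
move=> /and3P[v0 _ vd] /and3P[v'0 v'd _].
move=> /(wcylP _ q_gt0 q_sum1)[_ ve] /(wcylP _ q_gt0 q_sum1)[_ v'e].
rewrite leqNgt; apply/negP => v'v.
have lt1 : (size v' <= (size v).-1)%N by lia.
have q1 i : q i <= 1 by rewrite (le_trans (q_le i))// ltW//; case/andP: t01.
have antitone (a : nat -> nat) m n : (m <= n)%N -> cyl_length q a n <= cyl_length q a m.
  move=> /subnK <-; elim: (n - m)%N => // k IH; rewrite addSn cyl_lengthS.
  by rewrite (le_trans _ IH)// ger_pMr ?q1// cyl_length_gt0.
move: vd; rewrite ve take_mkseq ?size_mkseq ?leq_pred// wlen_mkseq ltNge => /negP; apply.
apply: le_trans (antitone _ _ _ lt1) _.
by rewrite -wlen_mkseq -v'e.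
Qed.

(* The exponent [1 - s] makes up for the inserted digits: a stopped word of rank
   [n] has [d < t ^ (n - 1)], so that the loss [rho ^ - n] is at most
   [rho^-1 * d ^ (s - 1)] where [rho = t ^ (1 - s)]. *)
Lemma wlen_free_digits_le (d : R) (a : nat -> nat) n : 0 < d -> stopped d (mkseq a n) ->
  (t `^ (1 - s)) ^+ n <= ins_prod q ins a n ->
  wlen q (free_digits ins a n) <= (t `^ (1 - s) * d `^ (1 - s))^-1 * cyl_length q a n.
Proof.
move=> d0; rewrite /stopped size_mkseq => /and3P[n0 _].
rewrite take_mkseq ?leq_pred// wlen_mkseq => dn adm.
have /andP[t0 t1] := t01.
have W0 : 0 < wlen q (free_digits ins a n) by exact: wlen_gt0.
rewrite -(wlen_free_digits q ins a n) mulrC -ler_pdivrMr; last first.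
  by rewrite invr_gt0 mulr_gt0// powR_gt0.
rewrite invrK ler_wpM2l// ?(ltW W0)// (le_trans _ adm)//.
rewrite -(prednK n0) exprS ler_wpM2l ?powR_ge0//.
rewrite -powR_mulrn ?powR_ge0// -powRrM mulrC powRrM powR_mulrn ?(ltW t0)//.
apply: ge0_ler_powR; rewrite ?nnegrE ?subr_ge0 ?(ltW d0) ?exprn_ge0 ?(ltW t0)//.
  by case/andP: s01 => _ /ltW.
by rewrite (le_trans (ltW dn))// cyl_length_le.
Qed.

(** Deletion lengthens the cylinder of an admissible stopped word by a factor of at most [K]. The
    stopped cylinders that meet [U] are disjoint and lie in an interval of length [4 * d], and
    [K * (4 * d)] is the bound claimed. *)
Lemma redigit_preimage_measure (U : set R) (d : R) : 0 < d < 1 ->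
  (forall y z, U y -> U z -> `|y - z| <= d) ->
  exists V : set R, [/\ measurable V,
    (lebesgue_measure V <= ((t `^ (1 - s))^-1 * 4 * d `^ s)%:E)%E &
    forall x z, 0 <= x < 1 -> 0 <= z < 1 -> redigit x z -> U z -> V x].
Proof.
move=> d01 Ud; have /andP[d0 d1] := d01.
have [->|/set0P[y Uy]] := eqVneq U set0.
  exists set0; split => //; rewrite measure0 lee_fin.
  by rewrite !mulr_ge0 ?invr_ge0 ?powR_ge0.
pose rho := t `^ (1 - s).
pose S w := [&& stopped d w,
  rho ^+ size w <= ins_prod q ins (nth 0%N w) (size w) &
  `[< wcyl q w `&` U !=set0 >]].
(* [F] lists the relevant stopped cylinders by the codes of their words, and [G] the cylinders left
   after deletion; all other codes contribute the empty set. The sets in [G] may overlap, which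
   subadditivity tolerates. *)
pose F (k : nat) :=
  if @pickle_inv (seq nat) k is Some w then if S w then wcyl q w else set0 else set0.
pose del w := free_digits ins (nth 0%N w) (size w).
pose G (k : nat) :=
  if @pickle_inv (seq nat) k is Some w then if S w then wcyl q (del w) else set0 else set0.
have mF k : measurable (F k).
  rewrite /F; case: pickle_inv => [w|]; last exact: measurable0.
  by case: ifP => _; [exact: measurable_wcyl|exact: measurable0].
have mG k : measurable (G k).
  rewrite /G; case: pickle_inv => [w|]; last exact: measurable0.
  by case: ifP => _; [exact: measurable_wcyl|exact: measurable0].
have mUF : measurable (\bigcup_k F k) by apply: bigcup_measurable => k _; exact: mF.
have mUG : measurable (\bigcup_k G k) by apply: bigcup_measurable => k _; exact: mG.
pose K := (rho * d `^ (1 - s))^-1.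
have K0 : 0 <= K by rewrite invr_ge0 mulr_ge0 ?powR_ge0.
exists (\bigcup_k G k); split=> //.
  apply: (@le_trans _ _ (\sum_(k <oo) lebesgue_measure (G k))%E).
    by apply: measure_sigma_subadditive => //.
  apply: (@le_trans _ _ (\sum_(k <oo) (K%:E * lebesgue_measure (F k)))%E).
    apply: lee_nneseries => // k _; rewrite /G /F.
    case: (@pickle_inv (seq nat) k) => [w|]; last by rewrite measure0 mule0.
    case: ifPn => [/and3P[stw admw _]|_]; last by rewrite measure0 mule0.
    rewrite !lebesgue_wcyl// -EFinM lee_fin [wlen q w]wlenE.
    apply: (wlen_free_digits_le d (nth 0%N w) (size w)) => //.
    by rewrite (_ : mkseq _ _ = w)// mkseq_nth.
  rewrite nneseriesZl//.
  have -> : (t `^ (1 - s))^-1 * 4 * d `^ s = K * (4 * d).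
    have e : d `^ (1 - s) * d `^ s = d.
      rewrite -powRD; last by rewrite subrK oner_eq0.
      by rewrite subrK powRr1// ltW.
    rewrite /K -[X in _ = _ * (4 * X)]e.
    have /andP[t0 _] := t01; have : t `^ (1 - s) != 0 by rewrite gt_eqF// powR_gt0.
    have : d `^ (1 - s) != 0 by rewrite gt_eqF// powR_gt0.
    rewrite /rho; move: (d `^ (1 - s)) (t `^ (1 - s)) (d `^ s) => u v z u0 v0.
    by field; rewrite u0 v0.
  rewrite EFinM lee_pmul//; first exact: nneseries_ge0.
  rewrite -measure_semi_bigcup//; last first.
    apply/trivIsetP => k l _ _ kl; rewrite -subset0 => x; rewrite /F => -[].
    have := @pickle_invK (seq nat) k; have := @pickle_invK (seq nat) l.
    case: (@pickle_inv (seq nat) k) => //= w.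
    case: (@pickle_inv (seq nat) l) => //= v vl wk.
    case: ifP => // /and3P[sw _ _] wx; case: ifP => // /and3P[sv _ _] vx.
    by move: kl; rewrite -vl -wk (stopped_uniq _ _ _ _ sw sv wx vx) eqxx.
  (* Each cylinder has length at most [d] and contains a point of [U], which is within [d] of
     [y]. *)
  apply: (@le_trans _ _ (lebesgue_measure `[y - 2 * d, y + 2 * d]%classic)).
    apply: le_measure; rewrite ?inE//.
    move=> x [k _]; rewrite /F; case: pickle_inv => // w; case: ifP => //.
    move=> /and3P[/and3P[_ wd _] _ /asboolP[z [wz Uz]]] wx.
    have := le_trans (wcyl_diam _ _ _ _ wx wz) wd; have := Ud _ _ Uz Uy.
    rewrite /= in_itv/= !ler_norml => /andP[? ?] /andP[? ?].
    by apply/andP; split; lra.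
  rewrite lebesgue_measure_itv/=; case: ifP => _; rewrite -?EFinB lee_fin; lra.
move=> x z x01 z01 [zx zadm] Uz.
(* The stopped prefix of the digits of [z] yields the member of [G] that contains [x]: deletion
   turns it into a prefix of the digits of [x]. *)
have [n sn] := stopped_exists d (digits q z) d01.
exists (pickle (mkseq (digits q z) n)) => //; rewrite /G pickleK_inv.
have nthE p : (p < n)%N -> nth 0%N (mkseq (digits q z) n) p = digits q z p.
  by move=> pn; rewrite nth_mkseq.
have -> : S (mkseq (digits q z) n).
  rewrite /S sn size_mkseq (eq_ins_prod _ _ _ _ _ nthE) zadm/=.
  apply/asboolP; exists z; split=> //.
  by apply/(wcylP _ q_gt0 q_sum1); rewrite size_mkseq.
rewrite /del size_mkseq (eq_free_digits _ _ _ _ nthE) zx.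
by apply/(wcylP _ q_gt0 q_sum1); rewrite size_mkseq.
Qed.

End CylinderCover.

(** * Choosing inserted digits *)

Lemma occ_gap i M a b n : (0 < M)%N ->
  (forall p, ~~ (M %| p.+1)%N -> a p = b p) ->
  (forall p, (M %| p.+1)%N -> a p = i /\ b p != i) ->
  occ i a n = (occ i b n + n %/ M)%N.
Proof.
move=> M0 ab abi; elim: n => [|n IH]; first by rewrite div0n addn0.
rewrite !occS IH divnS//; case: (boolP (M %| n.+1)%N) => [/abi[-> /negbTE ->]|/ab ->].
  by rewrite eqxx; lia.
by lia.
Qed.

(** The counts differ by [n %/ M], which is at least [n / (2 * M)] once [n >= M]. So the frequencies
    differ by a fixed amount at all late times, which separates the limsups whether or not limits
    exist. *)
Lemma limn_sup_occ_gap (R : realType) i M a b : (0 < M)%N ->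
  (forall p, ~~ (M %| p.+1)%N -> a p = b p) ->
  (forall p, (M %| p.+1)%N -> a p = i /\ b p != i) ->
  limn_sup (@occ_freq R i b) < limn_sup (@occ_freq R i a).
Proof.
move=> M0 ab abi.
pose e : R := (2 * M%:R)^-1.
have e0 : 0 < e by rewrite invr_gt0 mulr_gt0// ltr0n.
have gap n : (M <= n)%N -> @occ_freq R i b n + e <= occ_freq i a n.
  move=> Mn; have n0 : (0 < n)%N by exact: leq_trans Mn.
  rewrite /occ_freq (occ_gap _ _ _ _ _ M0 ab abi) natrD mulrDl lerD2l.
  rewrite ler_pdivlMr ?ltr0n// mulrC ler_pdivrMr ?mulr_gt0 ?ltr0n//.
  rewrite -!natrM ler_nat.
  have := divn_eq n M; have := ltn_pmod n M0; have : (0 < n %/ M)%N by rewrite divn_gt0.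
  nia.
pose S : R := limn_sup (@occ_freq R i b).
rewrite -/S; apply: (@lt_le_trans _ R (S + e / 2)); first by rewrite ltrDl divr_gt0.
apply: limn_sup_ge; first exact: occ_freq_bounded.
move=> N.
have lt_S : S - e / 2 < limn_sup (@occ_freq R i b) by rewrite ltrBlDr ltrDl divr_gt0.
have [n] := frequently_lt_limn_sup _ (occ_freq_bounded R i b) _ (maxn N M) lt_S.
rewrite geq_max => /andP[Nn Mn] h; exists n => //.
have := gap n Mn; lra.
Qed.

Lemma prod_dvdn (R : realType) (x : R) M n : (0 < M)%N ->
  \prod_(p < n) (if (M %| p.+1)%N then x else 1) = x ^+ (n %/ M).
Proof.
move=> M0; elim: n => [|n IH]; first by rewrite big_ord0 div0n.
rewrite big_ord_recr/= IH divnS//; case: ifP => _; last by rewrite mulr1.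
by rewrite add1n exprSr.
Qed.

(** A Weierstrass product inequality; the induction also carries the part [e / 2 ^ n] of [e] not yet
    spent. *)
Lemma prod_1B_geometric_ge (R : realType) (e : R) n : 0 <= e <= 1 ->
  1 - e <= \prod_(v < n) (1 - e / 2 ^+ v.+1).
Proof.
move=> /andP[e0 e1].
suff : 1 - e + e / 2 ^+ n <= \prod_(v < n) (1 - e / 2 ^+ v.+1).
  by apply: le_trans; rewrite lerDl divr_ge0// exprn_ge0.
elim: n => [|n IH]; first by rewrite big_ord0 expr0 divr1 subrK.
rewrite big_ord_recr/= exprS invfM.
set h := (2 ^+ n)^-1 in IH *.
have h0 : 0 <= h by rewrite invr_ge0 exprn_ge0.
have h1 : h <= 1 by rewrite invf_le1 ?exprn_gt0// exprn_ege1// ler1n.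
have P1 : 0 <= 1 - e * (2^-1 * h) by nra.
apply: le_trans (ler_wpM2r P1 IH).
have : 0 <= e * e * h * (1 - h) by rewrite !mulr_ge0 ?subr_ge0.
lra.
Qed.

Section Insertion.
Context {R : realType}.
Variable q : R^nat.
Hypothesis q_gt0 : forall i, 0 < q i.
Hypothesis q_le1 : forall i, q i <= 1.
Variable rho : R.
Hypothesis rho01 : 0 < rho < 1.

(** The admissible loss is shared out: digit [v] gets the factor [r v], all finite products of these
    being at least [rho], and a period long enough that [r v ^ K v <= q v] keeps it within its
    share. Divisibility by [M 0] confines all insertions to multiples of [M 0]. *)
Lemma insertion_periods : exists M : nat -> nat,
  [/\ forall v, (0 < M v)%N, forall v, (M 0 %| M v)%N &
   forall n V, rho ^+ n <= \prod_(v < V) q v ^+ (n %/ M v)].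
Proof.
have /andP[rho0 rho1] := rho01.
pose r v : R := 1 - (1 - rho) / 2 ^+ v.+1.
have h v : 0 < (2 ^+ v.+1)^-1 :> R by rewrite invr_gt0 exprn_gt0.
have h1 v : (2 ^+ v.+1)^-1 <= 1 :> R.
  by rewrite invf_le1 ?exprn_gt0// exprn_ege1// ler1n.
have r0 v : 0 < r v by rewrite /r; have := h v; have := h1 v; nra.
have r1 v : r v < 1 by rewrite /r; have := h v; have := h1 v; nra.
have exK v : exists K, (0 < K)%N /\ r v ^+ K <= q v.
  have : r v ^+ n @[n --> \oo] --> 0.
    by apply: cvg_expr; rewrite ger0_norm// ltW.
  move=> /cvgr_lt -/(_ _ (q_gt0 v))[N _ /(_ N.+1 (leqnSn N))/= hN].
  by exists N.+1; split => //; exact: ltW.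
have [K KP] := choice exK.
exists (fun v => if v is 0%N then K 0%N else (K 0%N * K v)%N); split.
- by move=> [|v]; rewrite ?muln_gt0 !(KP _).1.
- by move=> [|v]//; rewrite dvdn_mulr.
move=> n V.
apply: (@le_trans _ _ (\prod_(v < V) r v ^+ n)).
  rewrite prodrXl lerXn2r ?nnegrE ?(ltW rho0)//.
    by apply: prodr_ge0 => v _; exact: ltW.
  have := @prod_1B_geometric_ge R (1 - rho) V; rewrite subKr; apply.
  by apply/andP; split; lra.
apply: ler_prod => v _; rewrite exprn_ge0 ?(ltW (r0 v))//=.
set M := (X in (n %/ X)%N).
have KM : (K v <= M)%N.
  by rewrite /M; case: (nat_of_ord v) => [//|v']; rewrite leq_pmull// (KP _).1.
apply: (@le_trans _ _ ((r v ^+ K v) ^+ (n %/ M))).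
  rewrite -exprM ler_wiXn2l ?(ltW (r0 v)) ?(ltW (r1 v))//.
  by rewrite (leq_trans (leq_mul KM (leqnn _)))// mulnC leq_divM.
by rewrite lerXn2r ?nnegrE ?exprn_ge0 ?(ltW (r0 v)) ?(ltW (q_gt0 v))// (KP v).2.
Qed.

(** The positions [ins] are fixed before [a], so that one deletion map serves all points. *)
Lemma insertion_exists : exists ins : pred nat, forall a, exists b,
  [/\ forall p, ~~ ins p -> b p = a (free_count ins p),
      forall n, rho ^+ n <= ins_prod q ins b n &
      forall i, limn_inf (@occ_freq R i b) < limn_sup (@occ_freq R i b)].
Proof.
have [M [M0 M0M MP]] := insertion_periods.
pose ins := [pred p | (M 0 %| p.+1)%N].
exists ins => a.
pose base p := if ins p then 0%N else a (free_count ins p).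
(* [s v] puts [v] at the multiples of [M v] and [0] at the remaining reserved positions; in
   particular [s 0] is [base]. *)
pose s v p := if (M v %| p.+1)%N then v else base p.
have [c [cs cP]] := oscillating_mixture R s.
exists c; split.
- move=> p insp; have [v ->] := cs p; rewrite /s /base (negbTE insp).
  by case: ifP => // /(dvdn_trans (M0M v)) h; rewrite /ins/= h in insp.
(* [V] exceeds all digits used so far. The bound charges position [p] with every [q v] for which
   [M v] divides [p.+1], and an inserted [c p] is one of these [v], whichever sequence is being
   copied. *)
- move=> n; pose V := (\max_(p < n) c p).+1.
  apply: le_trans (MP n V) _.
  under eq_bigr do rewrite -prod_dvdn//.
  rewrite exchange_big/= /ins_prod [leRHS]big_mkcond/=; apply: ler_prod => p _.
  rewrite prodr_ge0/=; last by move=> v _; case: ifP => // _; exact: ltW.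
  have le1 (P : pred 'I_V) :
      \prod_(v < V | P v) (if (M v %| p.+1)%N then q v else 1) <= 1.
    by apply: prodr_ile1 => v _; case: ifP => _; rewrite ?ler01 ?lexx ?q_le1 ?ltW.
  case: ifP => // insp.
  have cV : (c p < V)%N by rewrite ltnS (leq_bigmax p).
  have Mc : (M (c p) %| p.+1)%N.
    by have [v ->] := cs p; rewrite /s; case: ifP => // _; rewrite /base/= insp.
  by rewrite (bigD1 (Ordinal cV))//= Mc ger_pMr.
(* Digit [0] is compared in [s 0] and [s 1], which gives up [0] at the multiples of [M 1]; a
   positive digit is compared in its own sequence and [s 0]. *)
- move=> [|i].
    apply: (cP 0%N 0%N 1%N); apply: (@limn_sup_occ_gap _ _ (M 1)) => // p.
      by rewrite /s /base/= => /negbTE ->; case: (M 0 %| p.+1)%N.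
    by move=> h; rewrite /s /base/= h (dvdn_trans (M0M 1) h).
  apply: (cP i.+1 i.+1 0%N); apply: (@limn_sup_occ_gap _ _ (M i.+1)) => // p.
    by rewrite /s /base/= => /negbTE ->; case: (M 0 %| p.+1)%N.
  by move=> h; rewrite /s /base/= h (dvdn_trans (M0M i.+1) h).
Qed.

End Insertion.

(** * Hausdorff measure *)

Section HausdorffBounds.
Context {R : realType}.
Implicit Types (E U : set R) (s d : R).

Lemma diam_ge0 U : (0 <= diam U)%E.
Proof.
rewrite /diam; case: ifPn => // /set0P[x Ux].
by apply: ereal_sup_ubound; exists (x, x) => //=; rewrite subrr normr0.
Qed.

Lemma diam_le U d : 0 <= d -> (forall y z, U y -> U z -> `|y - z| <= d) ->
  (diam U <= d%:E)%E.
Proof.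
move=> d0 Ud; rewrite /diam; case: ifPn => [_|_]; first by rewrite lee_fin.
by apply: ge_ereal_sup => _ [[y z] /= [Uy Uz] <-]; rewrite lee_fin; exact: Ud.
Qed.

Lemma dist_le_diam U y z : U y -> U z -> (`|y - z|%:E <= diam U)%E.
Proof.
move=> Uy Uz; rewrite /diam; case: ifPn => [/eqP U0|_]; first by rewrite U0 in Uy.
by apply: ereal_sup_ubound; exists (y, z).
Qed.

Lemma diam_pow_ge0 s U : (0 <= diam_pow s U)%E.
Proof. by rewrite /diam_pow; case: ifP => // _; exact: poweR_ge0. Qed.

Lemma hausdorff_content_ge0 d s E : (0 <= hausdorff_content d s E)%E.
Proof.
apply: le_ereal_inf_tmp => _ [U _ <-].
by apply: nneseries_ge0 => k _ _; exact: diam_pow_ge0.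
Qed.

Lemma hausdorff_content_le_measure d s E : 0 < d ->
  (hausdorff_content d s E <= hausdorff_measure s E)%E.
Proof. by move=> d0; apply: ereal_sup_ubound; exists d. Qed.

Lemma diam_pow_le U s d : 0 <= s -> 0 <= d ->
  (forall y z, U y -> U z -> `|y - z| <= d) -> (diam_pow s U <= (d `^ s)%:E)%E.
Proof.
move=> s0 d0 Ud; rewrite /diam_pow; case: ifP => _.
  by rewrite lee_fin powR_ge0.
rewrite -poweR_EFin; apply: gt0_ler_poweR;
  rewrite ?in_itv/= ?leey ?lee_fin ?d0 ?diam_ge0//.
exact: diam_le.
Qed.

(** Cutting the unit interval into [N.+1] pieces of length [h = 1 / (N + 1)] gives an [s]-sum of at
    most [(N + 1) * h ^ s = h ^ (s - 1)], which is small as [s > 1]. *)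
Lemma hausdorff_measure_unit_interval s E : 1 < s ->
  E `<=` [set x | 0 <= x < 1] -> hausdorff_measure s E = 0%E.
Proof.
move=> s1 E01; apply/eqP; rewrite eq_le; apply/andP; split; last first.
  exact: le_trans (hausdorff_content_ge0 1 s E) (hausdorff_content_le_measure _ _ _ _).
apply: ge_ereal_sup => _ [d /= d0 <-].
apply/lee_addgt0Pr => e e0; rewrite add0e.
have s10 : 0 < s - 1 by rewrite subr_gt0.
(* [h < m] will ensure both the mesh [h <= d] and the bound [h ^ (s - 1) <= e]. *)
pose m := Num.min d (e `^ (s - 1)^-1).
have m0 : 0 < m by rewrite lt_min d0 powR_gt0.
have [N _ /(_ N (leqnn N)) /= hN] := cvgr_lt 0 (@cvg_harmonic R) _ m0.
pose h : R := harmonic N.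
have h0 : 0 < h by exact: harmonic_gt0.
have hm : h < m by [].
have hE : N.+1%:R * h = 1 by rewrite /h /harmonic mulfV// pnatr_eq0.
pose U k : set R := if (k < N.+1)%N then `[k%:R * h, k.+1%:R * h[%classic else set0.
have Uh k y z : U k y -> U k z -> `|y - z| <= h.
  rewrite /U; case: ifP => // _; rewrite /= !in_itv/= -natr1 mulrDl mul1r.
  by move=> /andP[? ?] /andP[? ?]; rewrite ler_norml; apply/andP; split; lra.
have cov : E `<=` \bigcup_k U k.
  move=> x /E01/= /andP[x0 x1].
  have xh0 : 0 <= x / h by rewrite divr_ge0// ltW.
  have /andP[t1 t2] := truncn_itv xh0.
  exists (Num.truncn (x / h)) => //; rewrite /U.
  have -> : (Num.truncn (x / h) < N.+1)%N.
    rewrite -(ltr_nat R); apply: le_lt_trans t1 _.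
    by rewrite ltr_pdivrMr// hE.
  by rewrite /= in_itv/= -ler_pdivlMr// t1 -ltr_pdivrMr.
apply: (@le_trans _ _ (\sum_(k <oo) diam_pow s (U k))%E).
  apply: ereal_inf_lbound; exists U => //; split => // k.
  apply: (le_trans (diam_le _ _ (ltW h0) (Uh k))).
  rewrite lee_fin ltW// (lt_le_trans hm)//.
  by rewrite /m ge_min lexx.
rewrite (nneseries_split 0 N.+1); last by move=> k _; exact: diam_pow_ge0.
rewrite [X in (_ + X)%E]eseries0 ?adde0; last first.
  move=> k Nk _; rewrite /diam_pow /U ltnNge.
  by rewrite (_ : (N.+1 <= k)%N)//= eqxx.
apply: (@le_trans _ _ (\sum_(0 <= k < N.+1) (h `^ s)%:E)%E).
  apply: lee_sum => k _; apply: diam_pow_le; rewrite ?(ltW h0)//.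
    by rewrite (le_trans ler01)// ltW.
  exact: Uh.
rewrite sumEFin lee_fin big_const_nat subn0 iter_addr_0 -mulr_natl.
have -> : N.+1%:R * h `^ s = h `^ (s - 1).
  by rewrite -(mulr_powRB1 (ltW h0) (lt_trans ltr01 s1)) mulrA hE mul1r.
apply: (@le_trans _ _ (m `^ (s - 1))).
  by apply: ge0_ler_powR; rewrite ?nnegrE ?(ltW h0) ?(ltW m0) ?(ltW s10) ?(ltW hm).
apply: (@le_trans _ _ ((e `^ (s - 1)^-1) `^ (s - 1))).
  apply: ge0_ler_powR; rewrite ?nnegrE ?powR_ge0 ?(ltW m0) ?(ltW s10)//.
  by rewrite /m ge_min lexx orbT.
by rewrite -powRrM mulVf ?gt_eqF// powRr1// ltW.
Qed.

(* Mass distribution principle, for outer measures of preimages under a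
   relation [r] rather than for a measure on [E]. *)
Lemma hausdorff_measure_neq0 (r : R -> R -> Prop) (C s : R) E : 0 <= s -> 0 < C ->
  (forall x, 0 <= x < 1 -> exists2 z, E z & r x z) ->
  (forall U d, 0 < d < 1 -> (forall y z, U y -> U z -> `|y - z| <= d) ->
    exists V, [/\ measurable V,
      (lebesgue_measure V <= (C * d `^ s)%:E)%E &
      forall x z, 0 <= x < 1 -> E z -> r x z -> U z -> V x]) ->
  hausdorff_measure s E <> 0%E.
Proof.
move=> s0 C0 rE rU.
(* The assumption speaks of positive sizes only; a nonempty set of diameter [0] is treated with a
   positive size [d'], at an extra cost of at most [e]. *)
have capture U e : 0 < e -> (diam U <= (2^-1)%:E)%E ->
    exists V, [/\ measurable V,
      (lebesgue_measure V <= C%:E * diam_pow s U + e%:E)%E &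
      forall x z, 0 <= x < 1 -> E z -> r x z -> U z -> V x].
  move=> e0 dU.
  have [->|U0] := eqVneq U set0.
    exists set0; split => //; rewrite measure0.
    apply: adde_ge0; rewrite ?lee_fin ?(ltW e0)//.
    by rewrite mule_ge0 ?diam_pow_ge0// lee_fin ltW.
  have dfin : diam U = (fine (diam U))%:E.
    by rewrite fineK// ge0_fin_numE ?diam_ge0// (le_lt_trans dU)// ltry.
  set d := fine (diam U) in dfin.
  have d0 : 0 <= d by rewrite -lee_fin -dfin diam_ge0.
  have d2 : d <= 2^-1 by rewrite -lee_fin -dfin.
  have Ud y z : U y -> U z -> `|y - z| <= d.
    by move=> Uy Uz; rewrite -lee_fin -dfin; exact: dist_le_diam.
  rewrite /diam_pow (negbTE U0) dfin poweR_EFin.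
  have use d' : d <= d' -> 0 < d' < 1 -> C * d' `^ s <= C * d `^ s + e ->
      exists V, [/\ measurable V, (lebesgue_measure V <= C%:E * (d `^ s)%:E + e%:E)%E &
        forall x z, 0 <= x < 1 -> E z -> r x z -> U z -> V x].
    move=> dd' d'01 le.
    have Ud' y z : U y -> U z -> `|y - z| <= d'.
      by move=> Uy Uz; exact: le_trans (Ud y z Uy Uz) dd'.
    have [V [mV lV rV]] := rU U d' d'01 Ud'.
    by exists V; split=> //; apply: le_trans lV _; rewrite -EFinM -EFinD lee_fin.
  have [d_gt0|d_le0] := ltP 0 d; first by apply: (use d) => //; [lra|rewrite lerDl ltW].
  have dz : d = 0 by lra.
  rewrite dz in use *.
  (* At exponent [0] all powers are [1], even that of [0], so the size [1 / 2] costs nothing extra.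
     For [s > 0], [d'] is chosen with [C * d' ^ s <= e]. *)
  move: s0; rewrite le_eqVlt => /predU1P[s0|s_gt0].
    by apply: (use 2^-1); [lra|lra|rewrite -s0 !powRr0 lerDl ltW].
  pose d' := Num.min 2^-1 ((e / C) `^ s^-1).
  have d'0 : 0 < d' by rewrite lt_min powR_gt0 ?divr_gt0// invr_gt0 ltr0n.
  apply: (use d'); first exact: ltW.
    rewrite d'0/=; apply: (@le_lt_trans _ _ 2^-1); last by lra.
    by rewrite /d' ge_min lexx.
  rewrite powR0 ?gt_eqF// mulr0 add0r -ler_pdivlMl// mulrC.
  rewrite -[leRHS](powRr1 (ltW (divr_gt0 e0 C0))) -(mulVf (lt0r_neq0 s_gt0)) powRrM.
  apply: ge0_ler_powR; rewrite ?nnegrE ?powR_ge0 ?(ltW d'0) ?(ltW s_gt0)//.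
  by rewrite /d' ge_min lexx orbT.
move=> H0.
(* A cover of mesh [1 / 2], which keeps all sizes below [1], with sum [S] gives
   [1 <= C * S + 1 / 2]; the last term is the total of the errors [ek]. *)
suff : ((2 * C)^-1%:E <= hausdorff_measure s E)%E.
  by rewrite H0 lee_fin leNgt invr_gt0 mulr_gt0// ltr0n.
have half0 : 0 < 2^-1 :> R by rewrite invr_gt0 ltr0n.
apply: le_trans (hausdorff_content_le_measure _ s E half0).
apply: le_ereal_inf_tmp => _ [U [Ud EU] <-].
have ek k : 0 < 2^-1 / (2 ^ k.+1)%:R :> R by rewrite divr_gt0// ltr0n expn_gt0.
have [V VP] := choice (fun k => capture (U k) _ (ek k) (Ud k)).
have mV k : measurable (V k) by have [] := VP k.
have cov : `[0, 1[%classic `<=` \bigcup_k V k.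
  move=> x; rewrite /= in_itv/= => x01; have [z Ez rxz] := rE x x01.
  have [k _ Uz] := EU z Ez; exists k => //.
  by have [_ _ h] := VP k; exact: h rxz Uz.
have : (1 <= C%:E * \sum_(k <oo) diam_pow s (U k) + (2^-1)%:E)%E.
  have -> : 1%E = lebesgue_measure (`[0, 1[%classic : set R).
    by rewrite lebesgue_measure_itv/= lte_fin ltr01 sube0.
  apply: (@le_trans _ _ (\sum_(k <oo) lebesgue_measure (V k))%E).
    by apply: measure_sigma_subadditive.
  rewrite -nneseriesZl; last by move=> k _; exact: diam_pow_ge0.
  apply: le_trans (epsilon_trick xpredT _ (ltW half0)); last first.
    by move=> k; rewrite mule_ge0 ?diam_pow_ge0// lee_fin ltW.
  by apply: lee_nneseries => // k _; have [] := VP k.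
have : (0 <= \sum_(k <oo) diam_pow s (U k))%E.
  by apply: nneseries_ge0 => k _ _; exact: diam_pow_ge0.
case: (\sum_(k <oo) _)%E => [S||] //=; last by move=> _ _; rewrite leey.
rewrite !lee_fin => S0 h.
by rewrite invfM ler_pdivrMr// mulrC; lra.
Qed.

End HausdorffBounds.

(** * Both bounds for the dimension *)

Theorem theorem3 (R : realType) (q : nat -> R)
    (q_gt0 : forall i : nat, 0 < q i)
    (q_sum1 : series q @ \oo --> (1 : R)) :
  hausdorff_dim (essentially_nonnormal q) = 1%:E.
Proof.
apply/eqP; rewrite eq_le; apply/andP; split.
  apply/lee_addgt0Pr => e e0; apply: ereal_inf_lbound; exists (1 + e) => //.
  split; first by rewrite addr_ge0// ltW.
  by apply: hausdorff_measure_unit_interval; [rewrite ltrDl|move=> x []].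
apply: le_ereal_inf_tmp => _ [s [s0 Hs] <-]; rewrite lee_fin leNgt.
apply/negP => s1; move: Hs.
have [t t01 qt] := weights_bounded_away q q_gt0 q_sum1.
have /andP[t0 t1] := t01.
pose rho := t `^ (1 - s).
have rho01 : 0 < rho < 1.
  rewrite powR_gt0//= /rho -[ltRHS](congr1 (@^~ (1 - s)) (@powR1 R)).
  by apply: gt0_ltr_powR; rewrite ?nnegrE ?subr_gt0 ?(ltW t0).
have q_le1 i : q i <= 1 by rewrite (le_trans (qt i))// ltW.
have [ins insP] := insertion_exists q q_gt0 q_le1 rho rho01.
apply: (@hausdorff_measure_neq0 R (redigit q ins t s) (rho^-1 * 4)) => //.
- by rewrite mulr_gt0// invr_gt0; case/andP: rho01.
(* Every digit sequence is the expansion of a point, so [b] gives a [z] in the set from which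
   deletion recovers [x]. *)
- move=> x x01; have [b [b_free b_adm b_osc]] := insP (digits q x).
  have [z zb] := expansion_realized q q_gt0 q_sum1 b.
  have z01 := cylinder01 q q_gt0 q_sum1 _ 0 _ (zb 0%N).
  have bE : digits q z = b by apply/(digitsP q_gt0 q_sum1).
  exists z; rewrite /essentially_nonnormal /redigit /= /digit_freq /digit_count bE.
    by split.
  by split=> // n; exact: free_digits_mkseq.
move=> U d d01 Ud; have s01 : 0 <= s < 1 by rewrite s0.
have [V [mV lV hV]] :=
  redigit_preimage_measure q q_gt0 q_sum1 ins t s t01 qt s01 _ d d01 Ud.
by exists V; split=> // x z x01 [z01 _]; exact: hV.
Qed.
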